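(* Let $\mathbb{K}\in\{\mathbb{R},\mathbb{C}\}$, let $g,d,t\ge 1$ be integers, and let $p(x)=\sum_{|\alpha|=d}P_\alpha x^\alpha$, $P_\alpha\in\mathbb{K}$, be a homogeneous noncommutative polynomial of degree $d$ in $g$ noncommutative variables $x=(x_1,\dots,x_g)$ which satisfies the compatibility condition. Let $p_c$ be its commutative collapse, and let $A_j^{(s)}\in\mathbb{K}$ for $1\le s\le t$, $1\le j\le g$. Then $p_c$ has the Waring decomposition $$p_c(X)=\sum_{s=1}^t\left[A^{(s)}_1X_1+A^{(s)}_2X_2+\cdots+A^{(s)}_gX_g\right]^d$$ (with $X_1,\dots,X_g$ commuting variables) if and only if $p$ has the noncommutative Waring decomposition $$p(x)=\sum_{s=1}^t\left[A^{(s)}_1x_1+A^{(s)}_2x_2+\cdots+A^{(s)}_gx_g\right]^d .$$ In particular, the number of terms $t$ and the real (resp. complex) coefficients $A_j^{(s)}$ are the same in both decompositions.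
   Context: Noncommutative polynomials in $x_1,\dots,x_g$ are elements of the free associative algebra on $x_1,\dots,x_g$. For an index tuple $\alpha=(\alpha_1,\dots,\alpha_d)$ with $\alpha_i\in\{1,\dots,g\}$, write $|\alpha|=d$ and $x^\alpha=x_{\alpha_1}x_{\alpha_2}\cdots x_{\alpha_d}$. Let $\mathbb{1}_j^\alpha$ denote the number of positions $i$ with $\alpha_i=j$. The commutative collapse $p_c(X)$ of $p$ is the commutative polynomial obtained by replacing each $x_i$ by a commuting variable $X_i$, so $p_c(X)=\sum_{|\alpha|=d}P_\alpha X_{\alpha_1}\cdots X_{\alpha_d}$. Two index tuples $\alpha,\tilde\alpha$ of length $d$ are commutative equivalent, $\alpha\sim_c\tilde\alpha$, if $X_{\alpha_1}\cdots X_{\alpha_d}=X_{\tilde\alpha_1}\cdots X_{\tilde\alpha_d}$, equivalently $\mathbb{1}_j^\alpha=\mathbb{1}_j^{\tilde\alpha}$ for all $j=1,\dots,g$. The polynomial $p$ satisfies the compatibility condition if $P_\alpha=P_{\tilde\alpha}$ for all $\alpha\sim_c\tilde\alpha$. *)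

(* Defs.v *)
From mathcomp Require Import all_boot all_algebra.
From mathcomp Require Import reals complex.
(* The notations of monalg clash with those of mpoly. *)
From mathcomp Require Import -(notations) monalg.
From mathcomp Require Import mpoly.

Set Implicit Arguments.
Unset Strict Implicit.
Unset Printing Implicit Defensive.

Import GRing.Theory.
Local Open Scope ring_scope.

(* The free associative algebra K<x_1, ..., x_g>: the monoid algebra over K of
   the free monoid {fmonom 'I_g} of words in the letters 'I_g. *)
Notation "{ 'ncpoly' K [ g ] }" := (malg (fmonom 'I_g) K)
  (at level 0, K, g at level 2, format "{ 'ncpoly'  K [ g ] }") : type_scope.

Section NoncommutativePolynomials.
Context (K : numFieldType) (g : nat).

Definition ncX (i : 'I_g) : {ncpoly K[g]} :=
  mkmalgU (fmu i) 1.

(* x^alpha and X^alpha, for an index tuple given as a sequence of letters;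
   the product over a sequence respects the order of its entries. *)
Definition ncmon (w : seq 'I_g) : {ncpoly K[g]} := \prod_(i <- w) ncX i.

Definition cmon (w : seq 'I_g) : {mpoly K[g]} := \prod_(i <- w) 'X_i.

(* Substitution of the commuting variable 'X_i for x_i: the linear map sending
   each word w to cmon w. *)
Definition collapse : {ncpoly K[g]} -> {mpoly K[g]} :=
  monalg.mmap (@mpolyC g K) (fun w : fmonom 'I_g => cmon w).

Definition comm_equiv (d : nat) (a b : d.-tuple 'I_g) : Prop :=
  cmon a = cmon b.

Definition compatible (d : nat) (P : d.-tuple 'I_g -> K) : Prop :=
  forall a b : d.-tuple 'I_g, comm_equiv a b -> P a = P b.

Lemma ncmonE (w : seq 'I_g) : ncmon w = mkmalgU (FMonom w) 1.
Proof.
rewrite /ncmon; elim: w => [|i w IHw].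
  by rewrite big_nil; congr mkmalgU; apply: val_inj; exact: fm1.
by rewrite big_cons IHw malgM_def fgmulUU mulr1; congr mkmalgU;
  apply: val_inj; rewrite [LHS]fmM fmU.
Qed.

Lemma collapse_form (d : nat) (P : d.-tuple 'I_g -> K) :
  collapse (\sum_a P a *: ncmon a) = \sum_a P a *: cmon a.
Proof.
rewrite /collapse raddf_sum; apply: eq_bigr => a _.
rewrite ncmonE /=.
have -> : P a *: mkmalgU (FMonom a) 1 = mkmalgU (FMonom a) (P a).
  by apply/malgP => k; rewrite monalg.mcoeffZ !monalg.mcoeffU mulrnAr mulr1.
by rewrite monalg.mmapU mul_mpolyC.
Qed.

Lemma cmonE (w : seq 'I_g) :
  cmon w = 'X_[[multinom count_mem j w | j < g]].
Proof.
rewrite /cmon -(big_map (fun i => U_(i)%MM) xpredT (fun m => 'X_[m])).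
rewrite mpolyX_prod big_map; congr 'X_[_]; apply/mnmP => j.
rewrite mnm_sumE mnmE -sum1_count [RHS]big_mkcond /=.
by apply: eq_bigr => i _; rewrite mnm1E; case: eqP.
Qed.

Lemma comm_equivP (d : nat) (a b : d.-tuple 'I_g) :
  comm_equiv a b <-> forall j, count_mem j a = count_mem j b.
Proof.
rewrite /comm_equiv !cmonE; split=> [eq_ab j | eq_ab].
  move/(congr1 (mpoly.mcoeff [multinom count_mem i a | i < g])): eq_ab.
  rewrite !mcoeffX eqxx; case: eqP => [/mnmP/(_ j)|_ /eqP].
    by rewrite !mnmE.
  by rewrite oner_eq0.
by congr 'X_[_]; apply/mnmP => j; rewrite !mnmE.
Qed.

End NoncommutativePolynomials.

(* Main.v *)
(* Expanding the d-th powers, both sides become linear combinations of words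
   with the coefficients P_alpha and B_alpha = sum_s prod_i A^(s)_(alpha_i).
   The B_alpha are compatible since K is commutative. The coefficient of X^alpha
   in the collapse of a compatible form is its coefficient at x^alpha times the
   number of words equivalent to alpha; that number is nonzero in K, so
   compatible forms are determined by their collapses. *)
Require Import Defs.
From mathcomp Require Import all_boot all_algebra.
From mathcomp Require Import reals complex.
From mathcomp Require Import -(notations) monalg.
From mathcomp Require Import mpoly.

Import GRing.Theory.
Local Open Scope ring_scope.

(** Distributivity indexes the terms by functions ['I_d -> I], which are reindexed as tuples. Each
    product keeps its factors in order, so the expansion serves words and commuting monomials
    alike. *)
Lemma expr_sum_tuple (S : pzSemiRingType) (I : finType) (F : I -> S) (d : nat) :
  (\sum_j F j) ^+ d = \sum_(a : d.-tuple I) \prod_(i <- a) F i.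
Proof.
have -> : (\sum_j F j) ^+ d = \prod_(i < d) \sum_j F j.
  by rewrite prodr_const card_ord.
rewrite (bigA_distr_bigA (fun=> F)) /=.
rewrite (reindex (fun a : d.-tuple I => [ffun i => tnth a i])) /=.
  apply: eq_bigr => a _; rewrite big_tuple.
  by apply: eq_bigr => i _; rewrite ffunE.
exists (fun f : {ffun 'I_d -> I} => [tuple f i | i < d]) => [a|f] _.
  by apply: eq_from_tnth => i; rewrite tnth_mktuple ffunE.
by apply/ffunP => i; rewrite ffunE tnth_mktuple.
Qed.

Section CompatibleForms.
Context (K : numFieldType) (g d : nat).
Implicit Types (c : 'I_g -> K) (P B : d.-tuple 'I_g -> K).

Lemma ncscaleU (x : K) (w : seq 'I_g) :
  x *: ncmon K w = mkmalgU (FMonom w) x.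
Proof.
rewrite ncmonE; apply/malgP => k.
by rewrite monalg.mcoeffZ !monalg.mcoeffU mulrnAr mulr1.
Qed.

(* [GRing.scaler_prod] does not apply: [malg] over a noncommutative monoid is
   only a left algebra in the library. *)
Lemma ncscale_prod c (w : seq 'I_g) :
  \prod_(i <- w) (c i *: ncX K i) = (\prod_(i <- w) c i) *: ncmon K w.
Proof.
elim: w => [|i w IHw]; first by rewrite /ncmon !big_nil scale1r.
rewrite !big_cons {}IHw.
(* As a one-letter word, the left factor also becomes a [mkmalgU]: coefficients multiply and words
   concatenate. *)
have -> : ncX K i = ncmon K [:: i] by rewrite /ncmon big_seq1.
rewrite !ncscaleU malgM_def fgmulUU; congr mkmalgU.
by apply: val_inj; rewrite [LHS]fmM.
Qed.

Lemma ncform_exp c :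
  (\sum_(j < g) c j *: ncX K j) ^+ d =
  \sum_(a : d.-tuple 'I_g) (\prod_(i <- a) c i) *: ncmon K a.
Proof. by rewrite expr_sum_tuple; apply: eq_bigr => a _; exact: ncscale_prod. Qed.

Lemma cform_exp c :
  (\sum_(j < g) c j *: 'X_j) ^+ d =
  \sum_(a : d.-tuple 'I_g) (\prod_(i <- a) c i) *: cmon K a.
Proof. by rewrite expr_sum_tuple; apply: eq_bigr => a _; exact: scaler_prod. Qed.

Lemma comm_equiv_perm (a b : d.-tuple 'I_g) : comm_equiv K a b -> perm_eq a b.
Proof. by move/comm_equivP => eq_ab; apply/allP => j _; apply/eqP. Qed.

Lemma compatible_sum_prod (t : nat) (A : 'I_t -> 'I_g -> K) :
  compatible (fun a : d.-tuple 'I_g => \sum_(s < t) \prod_(i <- a) A s i).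
Proof.
by move=> a b /comm_equiv_perm eq_ab; apply: eq_bigr => s _; exact: perm_big.
Qed.

Lemma mcoeff_cform P (b : d.-tuple 'I_g) : compatible P ->
  (\sum_(a : d.-tuple 'I_g) P a *: cmon K a)
    @_[multinom count_mem j b | j < g] =
  P b *+ #|[pred a : d.-tuple 'I_g | cmon K a == cmon K b]|.
Proof.
move=> compP; rewrite raddf_sum -sumr_const [RHS]big_mkcond /=.
(* A term contributes [P b] when [a] is equivalent to [b], by compatibility, and 0 otherwise. *)
apply: eq_bigr => a _; rewrite mcoeffZ inE.
case: eqP => [eq_ab|neq_ab].
  by rewrite (compP a b eq_ab) eq_ab cmonE mcoeffX eqxx mulr1.
rewrite cmonE mcoeffX; case: eqP => [eq_m|_]; last by rewrite mulr0.
by case: neq_ab; rewrite !cmonE eq_m.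
Qed.

Lemma compatible_cform_inj P B : compatible P -> compatible B ->
  \sum_(a : d.-tuple 'I_g) P a *: cmon K a =
  \sum_(a : d.-tuple 'I_g) B a *: cmon K a ->
  P =1 B.
Proof.
move=> compP compB eqPB b.
move/(congr1 (mpoly.mcoeff [multinom count_mem j b | j < g])): eqPB.
(* In characteristic zero a positive multiplicity cancels; it is positive because [b] lies in its
   own class. *)
rewrite !mcoeff_cform //; apply: Num.Theory.pmulrnI.
by apply/card_gt0P; exists b; rewrite inE.
Qed.

End CompatibleForms.

Theorem theorem3p5 (R : realType) (K : numFieldType)
    (hK : K = (R : numFieldType) \/ K = (R[i] : numFieldType))
    (g d t : nat) (hg : (0 < g)%N) (hd : (0 < d)%N) (ht : (0 < t)%N)
    (P : d.-tuple 'I_g -> K) (p : {ncpoly K[g]})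
    (hp : p = \sum_(a : d.-tuple 'I_g) P a *: ncmon K a)
    (hP : compatible P)
    (A : 'I_t -> 'I_g -> K) :
  collapse p = \sum_(s < t) (\sum_(j < g) A s j *: 'X_j) ^+ d
  <->
  p = \sum_(s < t) (\sum_(j < g) A s j *: ncX K j) ^+ d.
Proof.
set B := fun a : d.-tuple 'I_g => \sum_(s < t) \prod_(i <- a) A s i.
have -> : \sum_(s < t) (\sum_(j < g) A s j *: 'X_j) ^+ d =
    \sum_(a : d.-tuple 'I_g) B a *: cmon K a.
  under eq_bigr do rewrite cform_exp.
  by rewrite exchange_big; apply: eq_bigr => a _; rewrite scaler_suml.
have -> : \sum_(s < t) (\sum_(j < g) A s j *: ncX K j) ^+ d =
    \sum_(a : d.-tuple 'I_g) B a *: ncmon K a.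
  under eq_bigr do rewrite ncform_exp.
  by rewrite exchange_big; apply: eq_bigr => a _; rewrite scaler_suml.
(* From noncommutative to commutative, it suffices to apply [collapse]. *)
split=> [|->]; last exact: collapse_form.
rewrite hp collapse_form => eqPB; apply: eq_bigr => a _; congr (_ *: _).
exact: (compatible_cform_inj _ _ _ _ _ hP (compatible_sum_prod _ _ _ _ A) eqPB).
Qed.
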